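(* Let $X$ be a finite set and let $C\subset \mathbf{SW}(X)$ be a set of simple words over $X$. The following two assertions are equivalent: (1) $C$ is a convex subset of $\mathbf{SW}(X)$; (2) $C=\mathrm{Bas}(f)$ for some Plott function $f$ on $X$ (where the basement is regarded as a set of simple words).
   Context: All sets are finite. A choice function on $X$ is a map $f:2^X\to 2^X$ with $f(A)\subset A$ for all $A\subset X$ (empty values are allowed). $f$ is a Plott function if $f(A\cup B)=f(f(A)\cup B)$ for all $A,B\subset X$. For choice functions, $f\le g$ means $f(A)\subset g(A)$ for all $A\subset X$. A simple word over $X$ is a finite sequence $w=x(1)x(2)\dots x(k)$ ($k\ge 0$, the empty word allowed) of pairwise distinct elements of $X$; $\mathrm{supp}(w)=\{x(1),\dots,x(k)\}$; $\mathbf{SW}(X)$ is the set of simple words over $X$. To $w$ one associates the choice function $l_w$: $l_w(A)=\{x(i)\}$ with $i$ the smallest index such that $x(i)\in A$, and $l_w(A)=\emptyset$ if $A\cap \mathrm{supp}(w)=\emptyset$. A linear Plott function is a Plott function $l$ with $|l(A)|\le 1$ for all $A$; the map $w\mapsto l_w$ is a bijection from $\mathbf{SW}(X)$ to the set of linear Plott functions on $X$, and the two sets are identified by it. The basement of a choice function $f$ is $\mathrm{Bas}(f)=\{l \text{ linear Plott function}: l\le f\}$, i.e., as a set of words, $\mathrm{Bas}(f)=\{w\in\mathbf{SW}(X): l_w\le f\}$. For a map of sets $\phi:Z\to X$, the map $\phi_\sharp:\mathbf{SW}(Z)\to\mathbf{SW}(X)$ sends a word $z(1)\dots z(k)$ to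 the word obtained from $\phi(z(1))\dots\phi(z(k))$ by keeping only the first occurrence of each letter. Given simple words $w_i$ over pairwise disjoint sets $X_i$ ($i\in I$, finite), a shuffle of the $w_i$ is a simple word over $\coprod_i X_i$ whose set of letters is $\coprod_i \mathrm{supp}(w_i)$ and in which, for each $i$, the letters of $w_i$ appear in the same relative order as in $w_i$. Given simple words $w_i$, $i\in I$, over the same set $X$, a melange of them is a word $\delta_\sharp(w)$, where $\delta:X\times I\to X$ is the projection and $w$ is a shuffle of the words $w_i'$, $w_i'$ being the copy of $w_i$ over $X\times\{i\}$. For $w,v\in\mathbf{SW}(X)$, $co(w,v)$ denotes the set of all prefixes (including the empty word and the full word) of all melanges of $w$ and $v$. A subset $C\subset\mathbf{SW}(X)$ is convex if $co(w,v)\subset C$ for all $w,v\in C$.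
   Formalization: The set C is assumed nonempty: the empty set of words is vacuously convex, but every basement contains the empty word, so the equivalence fails for empty C and only there. *)

(* Defs.v *)
From HB Require Import structures.
From mathcomp Require Import all_boot.

Set Implicit Arguments.
Unset Strict Implicit.
Unset Printing Implicit Defensive.

(** * Choice functions *)

Record choice_fun (X : finType) := ChoiceFun {
  choice_val :> {set X} -> {set X};
  choice_sub : forall A : {set X}, choice_val A \subset A }.

Definition plott (X : finType) (f : choice_fun X) : Prop :=
  forall A B : {set X}, f (A :|: B) = f (f A :|: B).

Definition choice_le (X : finType) (f g : choice_fun X) : bool :=
  [forall A : {set X}, f A \subset g A].

(** * Simple words *)

Record SW (X : finType) := SimpleWord { word :> seq X; word_uniq : uniq word }.

HB.instance Definition _ (X : finType) := [isSub for @word X].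
HB.instance Definition _ (X : finType) := [Equality of SW X by <:].
HB.instance Definition _ (X : finType) := [Choice of SW X by <:].
HB.instance Definition _ (X : finType) := [Countable of SW X by <:].

Lemma SW_size (X : finType) (w : SW X) : size w <= #|X|.
Proof. by rewrite -(card_uniqP (word_uniq w)) max_card. Qed.

Definition SW_bseq (X : finType) (w : SW X) : #|X|.-bseq X := Bseq (SW_size w).

Lemma SW_bseqK (X : finType) :
  pcancel (@SW_bseq X) (fun s : #|X|.-bseq X => insub (s : seq X)).
Proof. by move=> w; rewrite /= valK. Qed.

HB.instance Definition _ (X : finType) : isFinite (SW X) :=
  PCanIsFinite (@SW_bseqK X).

Definition supp (X : finType) (w : SW X) : {set X} := [set x in word w].

(** * The linear choice function of a simple word, and basements *)

(* [onth] returns [None] exactly when no letter of [w] lies in [A]. *)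
Definition lin_val (X : finType) (w : SW X) (A : {set X}) : {set X} :=
  if onth w (find (mem A) w) is Some x then [set x] else set0.

Lemma lin_sub (X : finType) (w : SW X) (A : {set X}) : lin_val w A \subset A.
Proof.
rewrite /lin_val; elim: (word w) => [|x s IHs] /=; first by rewrite sub0set.
by case: ifP => //= xA; rewrite sub1set.
Qed.

Definition lin (X : finType) (w : SW X) : choice_fun X := ChoiceFun (lin_sub w).

(* Linear Plott functions are identified with simple words through [lin]. *)
Definition Bas (X : finType) (f : choice_fun X) : {set SW X} :=
  [set w : SW X | choice_le (lin w) f].

(** * Shuffles, melanges and convexity *)

(* [undup] keeps the last occurrence of each letter, hence the reversals. *)
Definition first_occ (X : eqType) (s : seq X) : seq X := rev (undup (rev s)).

Lemma first_occ_uniq (X : eqType) (s : seq X) : uniq (first_occ s).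
Proof. by rewrite rev_uniq undup_uniq. Qed.

Definition sharp (Z X : finType) (phi : Z -> X) (w : SW Z) : SW X :=
  SimpleWord (first_occ_uniq (map phi w)).

(* Meant for words with pairwise disjoint supports in an ambient alphabet [Z];
   since [w] has no repeated letter, the letters of [ws i] occur in [w] in the
   same relative order iff [ws i] is a subsequence of [w]. *)
Definition is_shuffle (Z I : finType) (ws : I -> SW Z) (w : SW Z) : bool :=
  (supp w == \bigcup_i supp (ws i)) && [forall i, subseq (ws i) w].

Definition copy (X I : finType) (i : I) (w : SW X) : SW (X * I)%type :=
  sharp (fun x => (x, i)) w.

Definition melanges (X I : finType) (ws : I -> SW X) : {set SW X} :=
  [set sharp fst w | w : SW (X * I)%type & is_shuffle (fun i => copy i (ws i)) w].

Definition co (X : finType) (w v : SW X) : {set SW X} :=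
  [set u : SW X |
    [exists m in melanges (fun b : bool => if b then w else v), prefix u m]].

Definition convex (X : finType) (C : {set SW X}) : Prop :=
  forall w v : SW X, w \in C -> v \in C -> co w v \subset C.

(* Main.v *)
Require Import Defs.
From mathcomp Require Import all_boot.

Set Implicit Arguments.
Unset Strict Implicit.
Unset Printing Implicit Defensive.

(** The choice [lin w A] is the first letter of [w] that lies in [A].

    Basements are convex: in a shuffle of [w] and [v], let [z] be the first
    letter lying over [A]. All the letters that precede [z] in its own word also
    precede it in the shuffle, so [z] gives the choice of that word from [A].
    Hence a melange never chooses anything that neither [w] nor [v] would choose
    ([lin_melange]), and a prefix chooses even less ([lin_prefix]).

    Conversely, given a convex [C], take for [f] the pointwise union of the
    linear functions of its words ([choice_union]); such a union is
    path-independent ([plott_union]), and its basement contains [C]. To see that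
    a word [u] of the basement lies in [C], build up [u] letter by letter. If
    the prefix [p] is in [C] and the next letter is [x], test [lin u <= f] on the
    complement of [p]: some [w] in [C] has [x] as its first letter outside [p].
    The concatenation of [p] and [w] is a shuffle, and the corresponding melange
    starts with [p] followed by [x], since the letters of [w] before [x] are
    repetitions ([mem_co_cat], [convex_rcons]). The empty prefix is in [C]
    because it is a prefix of every melange and [C] has an element. *)

(** * First occurrences *)

Lemma mem_first_occ (T : eqType) (s : seq T) : first_occ s =i s.
Proof. by move=> x; rewrite /first_occ mem_rev mem_undup mem_rev. Qed.

Lemma first_occ_id (T : eqType) (s : seq T) : uniq s -> first_occ s = s.
Proof. by move=> Us; rewrite /first_occ undup_id ?rev_uniq // revK. Qed.

Lemma first_occ_cat (T : eqType) (s t : seq T) :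
  first_occ (s ++ t) = first_occ s ++ first_occ [seq x <- t | x \notin s].
Proof.
rewrite /first_occ rev_cat undup_cat rev_cat filter_undup -filter_rev.
by congr (_ ++ rev (undup _)); apply: eq_filter => x; rewrite mem_rev.
Qed.

Lemma first_occ_absorb (T : eqType) (s t : seq T) :
  uniq s -> {subset t <= s} -> first_occ (s ++ t) = s.
Proof.
move=> Us sts; rewrite first_occ_cat first_occ_id // -[RHS]cats0; congr (_ ++ _).
rewrite (@eq_in_filter _ _ pred0) ?filter_pred0 // => x /sts xs.
by rewrite xs.
Qed.

Lemma first_occ_new (T : eqType) (s t : seq T) (x : T) :
  x \notin s -> exists t', first_occ (s ++ x :: t) = first_occ s ++ x :: t'.
Proof.
move=> xs; rewrite first_occ_cat /= xs -cat1s first_occ_cat (@first_occ_id _ [:: x]) //.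
by eexists.
Qed.

(** * Linear choice functions *)

Lemma first_split (T : Type) (a : pred T) (s : seq T) : has a s ->
  exists p y t, [/\ s = p ++ y :: t, a y & ~~ has a p].
Proof. by case/split_find => y p t ay hp; exists p, y, t; rewrite cat_rcons. Qed.

Lemma lin_split (X : finType) (w : SW X) (A : {set X}) s x t :
  word w = s ++ x :: t -> x \in A -> ~~ has (mem A) s -> lin w A = [set x].
Proof.
move=> wE xA sA; rewrite /= /lin_val wE find_cat (negbTE sA) /= xA addn0.
by rewrite onth_cat ltnn subnn.
Qed.

Lemma linP (X : finType) (w : SW X) (A : {set X}) x :
  reflect (exists s t, [/\ word w = s ++ x :: t, x \in A & ~~ has (mem A) s])
          (x \in lin w A).
Proof.
apply: (iffP idP) => [xl | [s [t [ws xA sA]]]]; last first.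
  by rewrite (lin_split ws xA sA) set11.
have [/first_split [s [y [t [ws yA sA]]]] | wA] := boolP (has (mem A) w).
  by move: xl; rewrite (lin_split ws yA sA) => /set1P ->; exists s, t.
move: xl; rewrite /= /lin_val hasNfind // onth_default ?inE //.
Qed.

Lemma lin_incl (X : finType) (w : SW X) (A B : {set X}) x :
  B \subset A -> x \in B -> x \in lin w A -> lin w B = [set x].
Proof.
move=> sBA xB /linP [s [t [ws _ sA]]]; apply: lin_split ws xB _.
by apply: contra sA; apply: sub_has => y; apply: (subsetP sBA).
Qed.

Lemma lin_prefix (X : finType) (u m : SW X) (A : {set X}) :
  prefix u m -> lin u A \subset lin m A.
Proof.
case/prefixP => r mE; apply/subsetP => x /linP [s [t [us xA sA]]].
by apply/linP; exists s, (t ++ r); split=> //; rewrite mE us -catA.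
Qed.

(** * Melanges *)

Lemma word_copy (X I : finType) (i : I) (w : SW X) :
  word (copy i w) = [seq (x, i) | x <- w].
Proof.
by rewrite /= first_occ_id // map_inj_uniq ?word_uniq // => x y [].
Qed.

Lemma map_fst_copy (X I : finType) (i : I) (w : SW X) :
  map fst (word (copy i w)) = w.
Proof. by rewrite word_copy -map_comp map_id. Qed.

(** The restriction of a shuffle to the support of one of its words is that word,
    so cutting the shuffle at a letter [(x, i)] also cuts [ws i] at [x]. *)
Lemma lin_melange (X I : finType) (ws : I -> SW X) (m : SW X) (A : {set X}) x :
  m \in melanges ws -> x \in lin m A -> exists i, x \in lin (ws i) A.
Proof.
case/imsetP => z; rewrite inE => /andP [/eqP zsupp /forallP zsub] ->.
case/linP => s [t [mE xA sA]].
have zA : has (preim fst (mem A)) z.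
  rewrite -has_map; apply/hasP; exists x => //.
  by rewrite -mem_first_occ -[first_occ _]/(word (sharp fst z)) mE mem_cat mem_head orbT.
have [p [[y i] [r [zE /= yA pA]]]] := first_split zA.
have yNp : y \notin map fst p.
  by rewrite -has_map in pA; apply: contra pA => yp; apply/hasP; exists y.
have [r' sharpE] : exists r', word (sharp fst z) = first_occ (map fst p) ++ y :: r'.
  by rewrite /= zE map_cat; apply: first_occ_new.
have -> : x = y.
  have pA' : ~~ has (mem A) (first_occ (map fst p)).
    by rewrite (eq_has_r (mem_first_occ _)) has_map.
  by have := lin_split sharpE yA pA'; rewrite (lin_split mE xA sA) => /set1_inj.
have : (y, i) \in supp z by rewrite inE zE mem_cat mem_head orbT.
rewrite zsupp => /bigcupP [j _]; rewrite inE => yj.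
have Eij : i = j by move: yj; rewrite word_copy => /mapP [? _ []].
rewrite -{}Eij {j} in yj.
exists i; apply/linP.
have /(subseq_uniqP (word_uniq z)) := zsub i.
rewrite zE filter_cat [filter _ (_ :: _)]/= yj => /(congr1 (map fst)).
set a := (fun q => q \in _).
rewrite map_fst_copy map_cat /= => wE.
exists (map fst (filter a p)), (map fst (filter a r)); split=> //.
rewrite has_map; apply: contra pA => /hasP [q].
by rewrite mem_filter => /andP [_ qp] qA; apply/hasP; exists q.
Qed.

(** Concatenating the copies of [w] and [v] is a particular shuffle. *)
Lemma mem_co_cat (X : finType) (w v u : SW X) :
  prefix u (first_occ (w ++ v)) -> u \in co w v.
Proof.
move=> pu; rewrite inE; apply/existsP.
have Uz : uniq (copy true w ++ copy false v).
  rewrite cat_uniq !word_uniq andbT /=; apply/hasP => - [q] /=.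
  rewrite -[first_occ _]/(word (copy false v)) word_copy => /mapP [x _ ->].
  by rewrite -[first_occ _]/(word (copy true w)) word_copy => /mapP [? _].
pose z := SimpleWord Uz; exists (sharp fst z).
have -> : word (sharp fst z) = first_occ (w ++ v).
  by rewrite -[RHS]/(first_occ _) -{1}(map_fst_copy true w)
     -{1}(map_fst_copy false v) -map_cat.
rewrite pu andbT; apply/imsetP; exists z => //; rewrite inE; apply/andP; split.
  apply/eqP/setP => q; rewrite inE mem_cat; apply/orP/bigcupP.
    by case=> qw; [exists true | exists false]; rewrite // inE.
  by case=> - [] _; rewrite inE; [left | right].
by apply/forallP => - []; [apply: prefix_subseq | apply: suffix_subseq].
Qed.

(** * The union of the linear functions of a set of words *)

Definition union_val (X : finType) (C : {set SW X}) (A : {set X}) : {set X} :=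
  \bigcup_(w in C) lin w A.

Lemma union_sub (X : finType) (C : {set SW X}) A : union_val C A \subset A.
Proof. by apply/bigcupsP => w _; apply: choice_sub. Qed.

Definition choice_union (X : finType) (C : {set SW X}) : choice_fun X :=
  ChoiceFun (union_sub C).

Lemma lin_le_union (X : finType) (C : {set SW X}) w A :
  w \in C -> lin w A \subset choice_union C A.
Proof. by move=> wC; apply: (bigcup_sup w). Qed.

(** With [f] the union, replacing [A] by [f A] keeps the choice of each single
    word of [C]: if that word chooses [x] from [A :|: B] and [x] is in [A], then
    [x] is also its choice from [A], and thus lies in [f A]. *)
Lemma plott_union (X : finType) (C : {set SW X}) : plott (choice_union C).
Proof.
move=> A B; apply: eq_bigr => w wC.
set f := choice_union C.
have sub : f A :|: B \subset A :|: B by apply: setSU; apply: choice_sub.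
have key x : x \in lin w (A :|: B) -> lin w (f A :|: B) = [set x].
  move=> xl; apply: (lin_incl sub _ xl); rewrite inE.
  have := subsetP (choice_sub _ _) _ xl.
  rewrite inE => /orP [xA | ->]; last by rewrite orbT.
  rewrite (subsetP (lin_le_union A wC)) //.
  by rewrite (lin_incl (subsetUl A B) xA xl) set11.
apply/eqP; rewrite eqEsubset; apply/andP; split; apply/subsetP => x.
  by move=> /key ->; rewrite set11.
move=> xl; have /linP [s [t [ws xU _]]] := xl.
(* [w] meets [A :|: B] in [x], so it does choose something from it. *)
have /first_split [s' [y [t' [ws' yA sA]]]] : has (mem (A :|: B)) w.
  apply/hasP; exists x; first by rewrite ws mem_cat mem_head orbT.
  exact: (subsetP sub).
have yl : y \in lin w (A :|: B) by apply/linP; exists s', t'.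
by move: xl; rewrite (key _ yl) => /set1P ->.
Qed.

(** * Convex sets *)

Lemma convex_Bas (X : finType) (f : choice_fun X) : convex (Bas f).
Proof.
move=> w v; rewrite !inE => /forallP wf /forallP vf.
apply/subsetP => u; rewrite !inE => /existsP [m /andP [mm pum]].
apply/forallP => A; apply/subsetP => x /(subsetP (lin_prefix _ pum)) xm.
have [[] xl] := lin_melange mm xm.
  exact: (subsetP (wf A)).
exact: (subsetP (vf A)).
Qed.

(** The letters [s] of [w] preceding [x] already occur in [c], so the melange
    obtained from [c ++ w] starts with [c] followed by [x]. *)
Lemma convex_rcons (X : finType) (C : {set SW X}) (c w u : SW X) s x t :
    convex C -> c \in C -> w \in C ->
    word w = s ++ x :: t -> {subset s <= word c} -> word u = rcons c x ->
  u \in C.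
Proof.
move=> Ccv cC wC wE sc uE; apply: (subsetP (Ccv c w cC wC)).
have xc : x \notin word c.
  by have := word_uniq u; rewrite uE rcons_uniq => /andP [].
apply: mem_co_cat; rewrite wE catA.
have [|t' ->] := @first_occ_new _ (c ++ s) t x.
  by rewrite mem_cat negb_or xc; apply: contra xc => /sc.
by rewrite first_occ_absorb ?word_uniq // uE -cat_rcons prefix_prefix.
Qed.

Lemma Bas_union_convex (X : finType) (C : {set SW X}) :
  C != set0 -> convex C -> C = Bas (choice_union C).
Proof.
move=> /set0Pn [w0 w0C] Ccv.
apply/eqP; rewrite eqEsubset; apply/andP; split; apply/subsetP => u.
  by move=> uC; rewrite inE; apply/forallP => A; apply: lin_le_union.
rewrite inE => /forallP uf.
suff pref p t : word u = p ++ t -> exists2 c, c \in C & word c = p.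
  by have [c cC /val_inj <-] := pref _ _ (esym (cats0 u)).
elim/last_ind: p t => [|p x IHp] t uE.
  exists (SimpleWord (isT : uniq (nil : seq X))) => //.
  by apply: (subsetP (Ccv _ _ w0C w0C)); apply: mem_co_cat; rewrite prefix0s.
rewrite cat_rcons in uE; have [c cC cE] := IHp _ uE.
have Upx : uniq (rcons p x).
  by have := word_uniq u; rewrite uE -cat_rcons cat_uniq => /andP [].
have xp : x \notin p by move: Upx; rewrite rcons_uniq => /andP [].
pose A := [set y | y \notin p].
have : x \in lin u A.
  apply/linP; exists p, t; split; rewrite ?inE //.
  by apply/hasPn => y yp; rewrite /= inE negbK.
case/(subsetP (uf A))/bigcupP => w wC /linP [s [t' [wE _ sA]]].
exists (SimpleWord Upx) => //.
apply: (@convex_rcons _ _ c w _ s x t') => //=; last by rewrite cE.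
by move=> y ys; have /hasPn/(_ y ys) := sA; rewrite /= inE negbK cE.
Qed.

(* [C] must be nonempty: the empty set is vacuously convex, whereas every
   basement contains the empty word. *)
Theorem theorem4 (X : finType) (C : {set SW X}) (C_neq0 : C != set0) :
  convex C <-> exists f : choice_fun X, plott f /\ C = Bas f.
Proof.
split=> [Ccv | [f [_ ->]]]; last exact: convex_Bas.
by exists (choice_union C); split; [apply: plott_union | apply: Bas_union_convex].
Qed.
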